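(* Every 4-connected $\{K_{1,3},P_4\}$-free graph $G$ has an $H^2$ unless $G$ is isomorphic to a graph in one of the following families: (i) $(K_1\sqcup K_3)+(K_m\sqcup K_q)$ with $m+q\ge 4$; (ii) $(K_2\sqcup K_2)+(K_1\sqcup K_m)$ with $m\ge 3$; (iii) $(K_2\sqcup K_3)+(K_1\sqcup K_m)$ with $m\ge 3$; (iv) $(K_3\sqcup K_3)+(K_1\sqcup K_m)$ with $m\ge 3$.
   Context: All graphs are finite and simple. $P_4$ is the path on 4 vertices, $K_{1,3}$ the claw, $K_m$ the complete graph on $m$ vertices. $G\sqcup H$ denotes the vertex-disjoint union of $G$ and $H$; $G+H$ denotes the join, i.e. the disjoint union together with all edges between $V(G)$ and $V(H)$. A graph is $\{K_{1,3},P_4\}$-free if it has no induced subgraph isomorphic to $K_{1,3}$ or $P_4$. The square of a graph is obtained by adding edges joining all pairs of vertices at distance two. A graph $G$ has an $H^2$ if $G$ contains, as a subgraph, the square of some hamiltonian cycle of $G$. *)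

(* Defs.v *)
From mathcomp Require Import all_boot.

Set Implicit Arguments.
Unset Strict Implicit.
Unset Printing Implicit Defensive.

Record sgraph := SGraph {
  vertex :> finType;
  edge : rel vertex;
  edge_sym : symmetric edge;
  edge_irrefl : irreflexive edge }.

Arguments edge {s}.

Section Constructions.

Definition complete_edge n : rel 'I_n := [rel i j : 'I_n | i != j].

Lemma complete_edge_sym n : symmetric (@complete_edge n).
Proof. by move=> i j; rewrite /complete_edge /= eq_sym. Qed.

Lemma complete_edge_irrefl n : irreflexive (@complete_edge n).
Proof. by move=> i; rewrite /complete_edge /= eqxx. Qed.

Definition complete n := SGraph (@complete_edge_sym n) (@complete_edge_irrefl n).

Definition path_edge n : rel 'I_n := [rel i j : 'I_n | (i.+1 == j) || (j.+1 == i)].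

Lemma path_edge_sym n : symmetric (@path_edge n).
Proof. by move=> i j; rewrite /path_edge /= orbC. Qed.

Lemma path_edge_irrefl n : irreflexive (@path_edge n).
Proof. by move=> i; rewrite /path_edge /= orbb eqn_leq ltnn. Qed.

Definition path_graph n := SGraph (@path_edge_sym n) (@path_edge_irrefl n).

Definition bipartite_edge m n : rel ('I_m + 'I_n) :=
  fun x y => match x, y with
             | inl _, inr _ | inr _, inl _ => true
             | _, _ => false
             end.

Lemma bipartite_edge_sym m n : symmetric (@bipartite_edge m n).
Proof. by case=> [i|i] [j|j]. Qed.

Lemma bipartite_edge_irrefl m n : irreflexive (@bipartite_edge m n).
Proof. by case. Qed.

Definition complete_bipartite m n :=
  SGraph (@bipartite_edge_sym m n) (@bipartite_edge_irrefl m n).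

Variables G H : sgraph.

Definition union_edge : rel (G + H) :=
  fun x y => match x, y with
             | inl u, inl v => edge u v
             | inr u, inr v => edge u v
             | _, _ => false
             end.

Lemma union_edge_sym : symmetric union_edge.
Proof. by case=> [u|u] [v|v] //=; apply: edge_sym. Qed.

Lemma union_edge_irrefl : irreflexive union_edge.
Proof. by case=> u /=; apply: edge_irrefl. Qed.

Definition disjoint_union := SGraph union_edge_sym union_edge_irrefl.

Definition join_edge : rel (G + H) :=
  fun x y => match x, y with
             | inl u, inl v => edge u v
             | inr u, inr v => edge u v
             | _, _ => true
             end.

Lemma join_edge_sym : symmetric join_edge.
Proof. by case=> [u|u] [v|v] //=; apply: edge_sym. Qed.

Lemma join_edge_irrefl : irreflexive join_edge.
Proof. by case=> u /=; apply: edge_irrefl. Qed.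

Definition join := SGraph join_edge_sym join_edge_irrefl.

Variable S : {set G}.

Definition delete_edge : rel {x : G | x \notin S} :=
  [rel x y | edge (val x) (val y)].

Lemma delete_edge_sym : symmetric delete_edge.
Proof. by move=> x y; apply: edge_sym. Qed.

Lemma delete_edge_irrefl : irreflexive delete_edge.
Proof. by move=> x; apply: edge_irrefl. Qed.

Definition delete := SGraph delete_edge_sym delete_edge_irrefl.

End Constructions.

Definition isomorphic (G H : sgraph) : Prop :=
  exists2 f : G -> H, bijective f & forall x y, edge (f x) (f y) = edge x y.

Definition has_induced (G H : sgraph) : Prop :=
  exists2 f : H -> G, injective f & forall x y, edge (f x) (f y) = edge x y.

Definition claw_P4_free (G : sgraph) : Prop :=
  ~ has_induced G (complete_bipartite 1 3) /\ ~ has_induced G (path_graph 4).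

Definition connected (G : sgraph) : Prop :=
  forall x y : G, connect edge x y.

Definition k_connected (k : nat) (G : sgraph) : Prop :=
  k < #|G| /\ forall S : {set G}, #|S| < k -> connected (delete S).

Definition distance_two (T : finType) (e : rel T) : rel T :=
  [rel x y | [&& x != y, ~~ e x y & [exists z, e x z && e z y]]].

Definition square (T : finType) (e : rel T) : rel T :=
  [rel x y | e x y || distance_two e x y].

(* The edges of the cycle visiting the entries of c in cyclic order. *)
Definition cycle_edge (T : eqType) (c : seq T) : rel T :=
  [rel x y | (y == next c x) || (x == next c y)].

(* ucycle alone also accepts sequences of length 0 and 2. *)
Definition hamiltonian_cycle (G : sgraph) (c : seq G) : Prop :=
  [/\ 2 < size c, ucycle edge c & forall x : G, x \in c].

Definition has_H2 (G : sgraph) : Prop :=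
  exists2 c : seq G, hamiltonian_cycle c & subrel (square (cycle_edge c)) edge.

Definition clique_join (a b c d : nat) : sgraph :=
  join (disjoint_union (complete a) (complete b))
       (disjoint_union (complete c) (complete d)).

(* Complete graphs are nonempty, whence the positivity of m and q; with m = 0
   or q = 0 the first graph does contain the square of a hamiltonian cycle. *)
Definition exceptional (G : sgraph) : Prop :=
  [\/ exists m q, [/\ 0 < m, 0 < q, 4 <= m + q &
                      isomorphic G (clique_join 1 3 m q)],
      exists2 m, 3 <= m & isomorphic G (clique_join 2 2 1 m),
      exists2 m, 3 <= m & isomorphic G (clique_join 2 3 1 m)
    | exists2 m, 3 <= m & isomorphic G (clique_join 3 3 1 m)].

(* Main.v *)
(** A connected [P_4]-free graph has diameter at most two; together with
claw-freeness this excludes three pairwise nonadjacent vertices. Hence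
nonadjacency is triangle-free and closed under walks of length three: its
components are single vertices and complete bipartite graphs [K_{a,b}].
4-connectedness says that at least four vertices lie outside each such
biclique. A cyclic order of the vertices is a hamiltonian cycle whose square lies
in [G] as soon as the two sides of every biclique are at cyclic distance at least three. Writing
[A], [B] and [C], [D] for the sides of two bicliques, suitable orders are
[ArrBrr] when there is one biclique, [ACrBDr] when at least two vertices
(denoted [r]) lie outside both, [AACrBDD] when one does, and [AACCBBDD] or [CCACCBBDBB]
when none does; the sizes for which none of these applies are exactly the
exceptional ones. *)

Require Import Defs.
From mathcomp Require Import all_boot zify.

Set Implicit Arguments.
Unset Strict Implicit.
Unset Printing Implicit Defensive.

(** * Hamiltonian cycles from cyclic labellings *)

(* The cycle lists the vertices by increasing label; as every label is taken,
   the labels of consecutive vertices differ by at most one. *)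
Lemma labelling_H2 (G : sgraph) (k : nat) (f : G -> nat) :
    2 < k -> (forall x, f x < k) -> (forall i, i < k -> exists x, f x = i) ->
    (forall x y, x != y -> ~~ edge x y -> f x <= f y ->
       f x + 3 <= f y /\ f y + 3 <= f x + k) ->
  has_H2 G.
Proof.
move=> k_gt2 f_lt f_onto f_far.
have [x0 fx0] := f_onto 0 (leq_ltn_trans (leq0n _) k_gt2).
pose c := sort (relpre f leq) (enum G).
have c_uniq : uniq c by rewrite sort_uniq enum_uniq.
have c_mem x : x \in c by rewrite mem_sort mem_enum.
have c_sorted i j : i <= j -> j < size c -> f (nth x0 c i) <= f (nth x0 c j).
  move=> le_ij lt_j.
  have tr : transitive (relpre f leq) by move=> u v w; apply: leq_trans.
  have rf : reflexive (relpre f leq) by move=> u; rewrite /= leqnn.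
  apply: (@sorted_leq_nth _ (relpre f leq) tr rf x0 c) => //.
  - by apply: sort_sorted => u v; apply: leq_total.
  - by rewrite inE (leq_ltn_trans le_ij).
(* A jump would skip the label one above that of entry [i]; some vertex [z] carries it, but has no
   place in the sorted list. *)
have c_step i : i.+1 < size c -> f (nth x0 c i.+1) <= (f (nth x0 c i)).+1.
  move=> lt_i; rewrite leqNgt; apply/negP => jump.
  have [z fz] := f_onto _ (ltn_trans jump (f_lt _)).
  have ltz : index z c < size c by rewrite index_mem.
  have fz' : f (nth x0 c (index z c)) = (f (nth x0 c i)).+1 by rewrite nth_index.
  case: (leqP (index z c) i) => cmp.
  - by have := c_sorted _ _ cmp (ltnW lt_i); lia.
  - by have := c_sorted _ _ cmp ltz; lia.
have f_c0 : f (nth x0 c 0) = 0.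
  have := c_sorted 0 (index x0 c) (leq0n _); rewrite index_mem => /(_ (c_mem _)).
  by rewrite nth_index // fx0; lia.
have c_pos : 0 < size c by have := c_mem x0; case: (c).
have f_last : f (nth x0 c (size c).-1) = k.-1.
  have [z fz] := f_onto k.-1 ltac:(lia).
  have ltz : index z c < size c by rewrite index_mem.
  have := c_sorted (index z c) (size c).-1 ltac:(lia) ltac:(lia).
  by rewrite nth_index // fz; have := f_lt (nth x0 c (size c).-1); lia.
(* Climbing from label 0 to [k.-1], which is at least 2, by increments of at most one takes three
   vertices. *)
have c_size : 2 < size c.
  rewrite ltnNge; apply/negP => small.
  have := f_c0; have := f_last; have := c_step 0.
  by case: (size c) c_pos small => [|[|[|//]]] //= _ _; lia.
(* Contrapositive of [f_far]: distinct vertices whose labels are at cyclic distance at most two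
   modulo [k] are adjacent. *)
have close x y : x != y -> f x <= f y ->
    f y <= f x + 2 \/ f x + k <= f y + 2 -> edge x y.
  move=> neq le_xy near; apply: contraT => /(f_far _ _ neq) /(_ le_xy) [].
  by case: near; lia.
have next_c i : i < size c ->
    next c (nth x0 c i) = nth x0 c (if i.+1 < size c then i.+1 else 0).
  move=> lt_i; rewrite next_nth c_mem.
  case E : c => [|y p]; first by rewrite E in lt_i.
  rewrite -E index_uniq //.
  rewrite E /= in lt_i *; rewrite ltnS; case: ltnP => [lt_ip|le_pi].
    by apply: set_nth_default.
  by rewrite nth_default.
have nth_neq i j : i < size c -> j < size c -> i != j -> nth x0 c i != nth x0 c j.
  by move=> lt_i lt_j; rewrite nth_uniq.
have c_nth x : exists2 i, i < size c & x = nth x0 c i.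
  by exists (index x c); rewrite ?index_mem ?nth_index.
have E1 x : edge x (next c x).
  have [i lt_i ->] := c_nth x; rewrite next_c //; case: ltnP => [lt_i1|le_i1].
    apply: close; first by apply: nth_neq => //; lia.
      by apply: c_sorted.
    by have := c_step _ lt_i1; lia.
  have -> : i = (size c).-1 by lia.
  rewrite edge_sym; apply: close; first by apply: nth_neq => //; lia.
    by rewrite f_c0.
  by rewrite f_c0 f_last; lia.
have E2 x : edge x (next c (next c x)).
  have [i lt_i ->] := c_nth x; rewrite next_c //; case: ltnP => [lt_i1|le_i1].
    rewrite next_c //; case: ltnP => [lt_i2|le_i2].
      apply: close; first by apply: nth_neq => //; lia.
        by apply: c_sorted => //; lia.
      by have := c_step _ lt_i1; have := c_step _ lt_i2; lia.
    rewrite edge_sym; apply: close; first by apply: nth_neq => //; lia.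
      by rewrite f_c0.
    have := c_step _ lt_i1; have -> : i.+1 = (size c).-1 by lia.
    by rewrite f_c0 f_last; lia.
  rewrite next_c // ifT; last by lia.
  have -> : i = (size c).-1 by lia.
  rewrite edge_sym; apply: close; first by apply: nth_neq => //; lia.
    by apply: c_sorted => //; lia.
  by have := c_step 0 ltac:(lia); rewrite f_c0 f_last; lia.
have next_inj : injective (next c) by apply: can_inj (prev_next c_uniq).
exists c.
  split=> //; apply/andP; split=> //.
  by apply: cycle_from_next => // x _; apply: E1.
move=> x y /orP[/orP[]/eqP-> //|]; first by rewrite edge_sym.
(* If [z] follows both or precedes both of [x] and [y], then [x = y]; otherwise one of them is two
   steps after the other. *)
case/and3P => neq_xy _ /existsP[z /andP[]].
case/orP=> /eqP e1 /orP[] /eqP e2.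
- by rewrite e2 e1.
- by move: e2; rewrite e1 => /next_inj e; rewrite e eqxx in neq_xy.
- by rewrite e1 e2 eqxx in neq_xy.
- by rewrite e1 e2 edge_sym.
Qed.

(** * Induced paths and claws, and common neighbours *)

(** The vertices of [P_4] have pairwise distinct neighbourhoods, so a map that preserves adjacency
    is injective. The leaves of a claw are twins, hence the distinctness hypotheses of
    [claw_induced]. *)
Lemma path4_induced (G : sgraph) (a b c d : G) :
    edge a b -> edge b c -> edge c d -> ~~ edge a c -> ~~ edge b d ->
    ~~ edge a d -> has_induced G (path_graph 4).
Proof.
move=> ab bc cd /negbTE ac /negbTE bd /negbTE ad.
pose f (i : 'I_4) := nth a [:: a; b; c; d] i.
have fE i j : edge (f i) (f j) = path_edge i j.
  by case: i => [[|[|[|[|//]]]] ?]; case: j => [[|[|[|[|//]]]] ?];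
     rewrite /f /path_edge /= ?edge_irrefl // edge_sym.
exists f => // i j eq_ij; apply/val_inj.
have twin l : path_edge i l = path_edge j l by rewrite -!fE eq_ij.
have {eq_ij fE twin} := (twin ord0, twin (inord 1), twin (inord 2), twin ord_max).
rewrite /path_edge /= !inordK //.
by case: i => [[|[|[|[|//]]]] ?]; case: j => [[|[|[|[|//]]]] ?] [[[? ?] ?] ?].
Qed.

Lemma claw_induced (G : sgraph) (w x y z : G) :
    edge w x -> edge w y -> edge w z -> x != y -> x != z -> y != z ->
    ~~ edge x y -> ~~ edge x z -> ~~ edge y z ->
  has_induced G (complete_bipartite 1 3).
Proof.
move=> wx wy wz nxy nxz nyz /negbTE xy /negbTE xz /negbTE yz.
pose g (i : 'I_3) := nth x [:: x; y; z] i.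
pose f (u : complete_bipartite 1 3) : G := if u is inr i then g i else w.
have wg i : edge w (g i) by case: i => [[|[|[|//]]] ?].
have gg i j : edge (g i) (g j) = false.
  by case: i => [[|[|[|//]]] ?]; case: j => [[|[|[|//]]] ?];
    rewrite /g /= ?edge_irrefl // edge_sym.
have fE u v : edge (f u) (f v) = edge u v.
  case: u => u; case: v => v /=; first exact: edge_irrefl.
  - exact: wg.
  - by rewrite edge_sym wg.
  - exact: gg.
exists f => // -[i|i] [j|j] eq_ij; rewrite ?(ord1 i) ?(ord1 j) //.
- by have := wg j; rewrite -[g j]eq_ij edge_irrefl.
- by have := wg i; rewrite -[w]eq_ij edge_irrefl.
congr inr; apply/val_inj; move/eqP: eq_ij; rewrite /f /g.
rewrite nth_uniq //= ?inE ?negb_or ?nxy ?nxz ?nyz //.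
by move/eqP.
Qed.

(** Connectivity as an induction principle: [P] spreads along a path that avoids [S]. *)
Lemma connected_closed (G : sgraph) (k : nat) (S : {set G}) (P : pred G) (x y : G) :
    k_connected k G -> #|S| < k -> x \notin S -> y \notin S -> P x ->
    (forall u v, u \notin S -> v \notin S -> P u -> edge u v -> P v) -> P y.
Proof.
move=> [_ conn] S_small xS yS Px P_closed.
have along (u : delete S) p : P (val u) -> path edge u p -> P (val (last u p)).
  elim: p u => //= v p IHp u Pu /andP[uv]; apply: IHp.
  exact: P_closed (valP u) (valP v) Pu uv.
have /connectP[p p_path y_last] :=
  conn S S_small (exist _ x xS) (exist _ y yS).
by have := along (exist _ x xS) p Px p_path; rewrite -y_last.
Qed.

Definition nonadj (G : sgraph) : rel G := [rel x y | (x != y) && ~~ edge x y].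

Lemma edgeE (G : sgraph) (x y : G) : edge x y = (x != y) && ~~ nonadj x y.
Proof. by rewrite /nonadj /=; case: eqVneq => [->|_] /=; rewrite ?edge_irrefl ?negbK. Qed.

Lemma nonadj_sym (G : sgraph) : symmetric (@nonadj G).
Proof. by move=> x y; rewrite /nonadj /= eq_sym edge_sym. Qed.

(** The vertices at distance at most two from [x] are closed under adjacency: a first vertex [v]
    beyond them would end an induced path [x w u v]. *)
Lemma common_neighbour (G : sgraph) (k : nat) (x y : G) :
    k_connected k G -> 0 < k -> ~ has_induced G (path_graph 4) -> nonadj x y ->
  exists2 w, edge x w & edge w y.
Proof.
move=> conn k_gt0 noP4 /andP[neq_xy nadj_xy].
pose near v := [|| v == x, edge x v | [exists w, edge x w && edge w v]].
suff : near y.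
  rewrite /near eq_sym (negbTE neq_xy) (negbTE nadj_xy) /=.
  by case/existsP=> w /andP[]; exists w.
apply: (connected_closed (x := x) (S := set0) conn); rewrite ?cards0 ?inE //.
  by rewrite /near eqxx.
move=> u v _ _ near_u uv; case/or3P: near_u.
- by move=> /eqP eq_u; rewrite /near -eq_u uv orbT.
- by move=> xu; apply/or3P/Or33/existsP; exists u; rewrite xu.
case/existsP=> w /andP[xw wu]; apply: contraT; rewrite !negb_or.
case/and3P=> _ nadj_xv /existsPn far_v; case: noP4.
apply: (@path4_induced G x w u v) => //.
- by have := far_v u; rewrite uv andbT.
- by have := far_v w; rewrite xw.
Qed.

Lemma exists_other (T : finType) (A : {set T}) x : 1 < #|A| -> exists2 a, a \in A & a != x.
Proof.
move/card_gt1P => [a [b [Aa Ab neq_ab]]]; have [eq_ax|] := eqVneq a x; last by exists a.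
by exists b; rewrite // -eq_ax eq_sym.
Qed.

(** * Relations whose components are vertices or complete bipartite graphs *)

Section Bicliques.

Variables (T : finType) (N : rel T).

(* The last two conditions say that every connected component of [N] is a
   vertex or a complete bipartite graph. *)
Definition bicliques : Prop :=
  [/\ symmetric N, forall x y z, N x y -> N y z -> ~~ N x z
    & forall x y z w, N x y -> N y z -> N z w -> N x w].

Hypothesis hN : bicliques.

Definition nbr (x : T) : {set T} := [set z | N x z].

Lemma bicliques_sym : symmetric N. Proof. by case: hN. Qed.

Lemma bicliques_triangle x y z : N x y -> N y z -> ~~ N x z.
Proof. by case: hN => _ + _; apply. Qed.

Lemma bicliques_walk3 x y z w : N x y -> N y z -> N z w -> N x w.
Proof. by case: hN => _ _; apply. Qed.

Lemma bicliques_irrefl x : N x x = false.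
Proof. by apply/negP => xx; have := bicliques_triangle xx xx; rewrite xx. Qed.

(** All neighbours of [x] have the same neighbourhood, so comparing the ranks of [nbr x] and [nbr y]
    does not depend on the neighbour [y]. The two ranks differ because [y] lies in [nbr x] but not
    in [nbr y]. *)
Lemma bicliques_bipartite : exists side : T -> bool, forall x y, N x y -> side x != side y.
Proof.
pose side x := [exists y, N x y && (enum_rank (nbr x) < enum_rank (nbr y))].
have sideE x y : N x y -> side x = (enum_rank (nbr x) < enum_rank (nbr y)).
  move=> xy; apply/existsP/idP => [[z /andP[xz]]|lt_xy]; last by exists y; rewrite xy.
  suff -> : nbr z = nbr y by [].
  have walk u v : N x u -> N x v -> nbr u \subset nbr v.
    move=> xu xv; apply/subsetP => w; rewrite !inE; apply: bicliques_walk3 xu.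
    by rewrite bicliques_sym.
  by apply/eqP; rewrite eqEsubset !walk.
exists side => x y xy; rewrite (sideE _ _ xy) (sideE y x) ?[N y x]bicliques_sym //.
suff : nbr x != nbr y by rewrite -(inj_eq enum_rank_inj) -(inj_eq val_inj) /=; case: ltngtP.
by apply/negP => /eqP /setP /(_ y); rewrite !inE xy bicliques_irrefl.
Qed.

(* [biclique_pair x1 y1 x2 y2] selects a pair of distinct components of [N],
   with sides [nbr y1], [nbr x1] and [nbr y2], [nbr x2] respectively. *)
Definition biclique_pair (x1 y1 x2 y2 : T) : bool :=
  [&& N x1 y1, N x2 y2, ~~ N x1 x2 & ~~ N y1 x2].

Lemma biclique_pair_flip1 x1 y1 x2 y2 :
  biclique_pair x1 y1 x2 y2 -> biclique_pair y1 x1 x2 y2.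
Proof. by case/and4P=> N1 N2 x12 yx; rewrite /biclique_pair bicliques_sym N1 N2 x12 yx. Qed.

Lemma biclique_pair_swap x1 y1 x2 y2 :
  biclique_pair x1 y1 x2 y2 -> biclique_pair x2 y2 x1 y1.
Proof.
case/and4P=> N1 N2 x12 yx; rewrite /biclique_pair N1 N2 bicliques_sym x12 /=.
(* A pair [N y2 x1] would complete the walk [y1 x1 y2 x2], forcing [N y1 x2]. *)
apply: contra yx => yx; rewrite bicliques_sym in N1.
by apply: bicliques_walk3 N1 _ _; [rewrite bicliques_sym; exact: yx | rewrite bicliques_sym].
Qed.

Lemma biclique_pair_flip2 x1 y1 x2 y2 :
  biclique_pair x1 y1 x2 y2 -> biclique_pair x1 y1 y2 x2.
Proof. by move/biclique_pair_swap/biclique_pair_flip1/biclique_pair_swap. Qed.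

(* Blocks 0, 1, 2, 3 are the sides A, B, C, D of the header, namely [nbr y1],
   [nbr x1], [nbr y2], [nbr x2]; block 4 consists of the other vertices. *)
Definition block (x1 y1 x2 y2 x : T) : nat :=
  if N y1 x then 0 else if N x1 x then 1 else
  if N y2 x then 2 else if N x2 x then 3 else 4.

Section Pair.

Variables x1 y1 x2 y2 : T.
Hypothesis pair : biclique_pair x1 y1 x2 y2.

Let cls := block x1 y1 x2 y2.

(** The four sides are pairwise disjoint, so the order of the tests in [block] is immaterial:
    opposite sides by triangle-freeness, sides of different components because a shared vertex would
    give a walk of length three between them. *)
Lemma blockP : [/\ forall x, (cls x == 0) = N y1 x, forall x, (cls x == 1) = N x1 x,
  forall x, (cls x == 2) = N y2 x & forall x, (cls x == 3) = N x2 x].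
Proof.
have [N1 N2 _ _] := and4P pair.
have disj u v x : N u v -> N u x -> N v x = false.
  by move=> uv ux; apply/negP => vx; have := bicliques_triangle uv vx; rewrite ux.
have cross a b c d : biclique_pair a b c d -> N a d = false.
  by move/biclique_pair_flip2/and4P=> [_ _ /negbTE].
have cross2 a b c d x : biclique_pair a b c d -> N a x -> N c x = false.
  move=> p ax; apply/negP => cx; have [_ cd _ _] := and4P p.
  have := cross _ _ _ _ p; rewrite (bicliques_walk3 ax (z := c) (w := d)) //.
  by rewrite bicliques_sym.
have p' := biclique_pair_flip1 pair.
have c1 x := cross2 _ _ _ _ x pair.
have c2 x := cross2 _ _ _ _ x p'.
have c3 x := cross2 _ _ _ _ x (biclique_pair_flip2 pair).
have c4 x := cross2 _ _ _ _ x (biclique_pair_flip2 p').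
have d1 x := disj _ _ x N1.
have d2 x := disj _ _ x N2.
split=> x; move: (c1 x) (c2 x) (c3 x) (c4 x) (d1 x) (d2 x); rewrite /cls /block;
  case: (N y1 x); case: (N x1 x); case: (N y2 x); case: (N x2 x) => /= e1 e2 e3 e4 e5 e6;
  by [| have := e1 isT | have := e2 isT | have := e3 isT | have := e4 isT
      | have := e5 isT | have := e6 isT].
Qed.

(** The list exchanges opposite sides; its default 4 keeps the neighbours of a remaining vertex
    among the remaining vertices. *)
Lemma block_mate x y : N x y -> cls y = nth 4 [:: 1; 0; 3; 2] (cls x).
Proof.
have [B0 B1 B2 B3] := blockP; have [N1 N2 _ _] := and4P pair.
have [M1 M2] : N y1 x1 /\ N y2 x2 by split; rewrite bicliques_sym.
have mate u v : N u v -> [/\ cls u = 0 -> cls v = 1, cls u = 1 -> cls v = 0,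
    cls u = 2 -> cls v = 3 & cls u = 3 -> cls v = 2].
  move=> uv; split=> /eqP; rewrite ?B0 ?B1 ?B2 ?B3 => h; apply/eqP; rewrite ?B0 ?B1 ?B2 ?B3.
  - exact: bicliques_walk3 N1 h uv.
  - exact: bicliques_walk3 M1 h uv.
  - exact: bicliques_walk3 N2 h uv.
  - exact: bicliques_walk3 M2 h uv.
move=> xy; have [m0 m1 m2 m3] := mate x y xy.
have [m0' m1' m2' m3'] := mate y x ltac:(by rewrite bicliques_sym).
have cls_le u : cls u <= 4 by rewrite /cls /block; do 4?case: ifP.
have := cls_le x; have := cls_le y.
by case: (cls x) m0 m1 m2 m3 m0' m1' m2' m3' => [|[|[|[|[|//]]]]] /=;
  case: (cls y) => [|[|[|[|[|//]]]]] m0 m1 m2 m3 m0' m1' m2' m3' //;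
  by [have := m0 erefl|have := m1 erefl|have := m2 erefl|have := m3 erefl|
      have := m0' erefl|have := m1' erefl|have := m2' erefl|have := m3' erefl].
Qed.

(** For the converse of [block_mate], the chosen representatives of the two sides form a walk of
    length three from [x] to [y]. *)
Lemma block_complete x y : cls x < 4 -> N x y = (cls y == nth 4 [:: 1; 0; 3; 2] (cls x)).
Proof.
have [B0 B1 B2 B3] := blockP; have [N1 N2 _ _] := and4P pair.
have [M1 M2] : N y1 x1 /\ N y2 x2 by split; rewrite bicliques_sym.
move=> lt4; apply/idP/idP => [/block_mate -> //|].
have walk u v : N u v -> N u x -> N v y -> N x y.
  by rewrite [N u x]bicliques_sym => uv xu vy; apply: bicliques_walk3 xu uv vy.
case E : (cls x) lt4 => [|[|[|[|//]]]] _ /=; move/eqP: E; rewrite ?B0 ?B1 ?B2 ?B3; exact: walk.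
Qed.

Lemma block_rest x : (cls x < 4) = [|| N y1 x, N x1 x, N y2 x | N x2 x].
Proof. by rewrite /cls /block; do 4!case: ifP => //= _. Qed.

(** The indices cross because each representative lies in the neighbourhood of the other. *)
Lemma block_reps : [/\ cls x1 = 0, cls y1 = 1, cls x2 = 2 & cls y2 = 3].
Proof.
have [B0 B1 B2 B3] := blockP; have [N1 N2 _ _] := and4P pair.
by split; apply/eqP; rewrite ?B0 ?B1 ?B2 ?B3 // bicliques_sym.
Qed.

Lemma card_outside_le :
  #|~: (nbr x1 :|: nbr y1)| <= #|nbr y2| + #|nbr x2| + #|[set x | 4 <= cls x]|.
Proof.
apply: leq_trans (leq_trans (leq_card_setU (nbr y2 :|: nbr x2) [set x | 4 <= cls x]) _); last first.
  by rewrite leq_add2r leq_card_setU.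
apply/subset_leq_card/subsetP => x; rewrite !inE leqNgt block_rest.
by case: (N x1 x) (N y1 x) (N x2 x) (N y2 x) => [] [] [] [].
Qed.

End Pair.
End Bicliques.

(** * Nonadjacency under the connectivity and freeness hypotheses *)

(** Given pairwise nonadjacent [x], [y], [z], take common neighbours [w] of [x, y] and [w'] of
    [y, z]. Claw-freeness makes [w z] and [x w'] nonadjacent, so [x w w' z] or [x w y w'] is an
    induced [P_4], according to whether [w w'] is an edge. *)
Lemma nonadj_bicliques (G : sgraph) (k : nat) :
  k_connected k G -> 0 < k -> claw_P4_free G -> bicliques (@nonadj G).
Proof.
move=> conn k_gt0 [noclaw noP4]; have sym := @nonadj_sym G.
have tri (x y z : G) : nonadj x y -> nonadj y z -> ~~ nonadj x z.
  move=> xy yz; apply/negP => xz.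
  have [w xw wy] := common_neighbour conn k_gt0 noP4 xy.
  have [w' yw' w'z] := common_neighbour conn k_gt0 noP4 yz.
  have [/andP[nxy exy] /andP[nyz eyz] /andP[nxz exz]] := And3 xy yz xz.
  have wz : ~~ edge w z.
    by apply/negP => wz; apply: noclaw; apply: (@claw_induced G w x y z); rewrite // edge_sym.
  have xw' : ~~ edge x w'.
    apply/negP => xw'; apply: noclaw.
    by apply: (@claw_induced G w' x y z) => //; rewrite edge_sym.
  case ww' : (edge w w').
    by apply: noP4; apply: (@path4_induced G x w w' z).
  by apply: noP4; apply: (@path4_induced G x w y w') => //; rewrite ww'.
split=> // x y z w xy yz zw.
have xz := tri _ _ _ xy yz; have yw := tri _ _ _ yz zw.
have [eq_xz|neq_xz] := eqVneq x z; first by rewrite eq_xz.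
have [eq_yw|neq_yw] := eqVneq y w; first by rewrite -eq_yw.
have [eq_xw|neq_xw] := eqVneq x w.
  by rewrite eq_xw sym zw in xz.
(* [P_4] is self-complementary: an edge [x w] turns the nonadjacency walk [x y z w] into the induced
   path [z x w y]. *)
apply: contraT => nadj_xw; case: noP4.
move: xz yw nadj_xw xy yz zw; rewrite /nonadj /= neq_xz neq_yw neq_xw /= !negbK.
move=> xz yw xw /andP[_ xy] /andP[_ yz] /andP[_ zw].
by apply: (@path4_induced G z x w y) => //; rewrite edge_sym.
Qed.

(** Deleting everything outside a biclique of nonadjacency leaves two sides with no edge of [G]
    between them, hence a disconnected graph. *)
Lemma card_outside_biclique (G : sgraph) (k : nat) (x y : G) :
    k_connected k G -> bicliques (@nonadj G) -> nonadj x y ->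
  k <= #|~: (nbr (@nonadj G) x :|: nbr (@nonadj G) y)|.
Proof.
move=> conn hN xy; rewrite leqNgt; apply/negP => small.
have yx : nonadj y x by rewrite nonadj_sym.
suff : nonadj y y by rewrite (bicliques_irrefl hN).
apply: (connected_closed (P := nonadj y) conn small) (yx) _; rewrite ?inE ?negbK ?xy ?yx ?orbT //.
move=> u v _; rewrite !inE negbK => /orP[xv|//] yu; rewrite edgeE andbC.
suff -> : nonadj u v by [].
by apply: (bicliques_walk3 hN _ yx xv); rewrite nonadj_sym.
Qed.

(** * Explicit cyclic arrangements *)

Section Arrangements.

Variable G : sgraph.
Hypothesis hN : bicliques (@nonadj G).

Notation N := (@nonadj G).
Notation nb x := #|nbr N x|.

Lemma nonadj_labelling_H2 (k : nat) (f : G -> nat) :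
    2 < k -> (forall x, f x < k) -> (forall i, i < k -> exists x, f x = i) ->
    (forall x y, N x y -> f x <= f y -> f x + 3 <= f y /\ f y + 3 <= f x + k) ->
  has_H2 G.
Proof.
move=> k_gt2 f_lt f_onto far; apply: (labelling_H2 k_gt2 f_lt f_onto) => x y neq nadj.
by apply: far; rewrite /nonadj /= neq.
Qed.

Lemma H2_complete : (forall x y, ~~ N x y) -> 2 < #|G| -> has_H2 G.
Proof.
move=> complG big; apply: (@nonadj_labelling_H2 #|G| enum_rank big) => [x|i lt_i|x y xy].
- exact: ltn_ord.
- by exists (enum_val (Ordinal lt_i)); rewrite enum_valK.
- by have := complG x y; rewrite xy.
Qed.

(* Order A s_0 s_1 B s_2 (rest). *)
Lemma H2_one_biclique x y : N x y -> 4 <= #|~: (nbr N x :|: nbr N y)| ->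
    (forall u v, N u v -> N x u || N y u) -> has_H2 G.
Proof.
move=> xy /card_geqP [s [s_uniq s_size s_out]] only.
have yx : N y x by rewrite nonadj_sym.
have disj u : N x u -> N y u -> False.
  by move=> xu yu; have := bicliques_triangle hN xy yu; rewrite xu.
(* The default 5 goes to the fourth entry of [s] and to every other vertex outside the biclique; the
   fourth entry ensures that this label is taken. Labels 0 and 3 are opposite modulo 6. *)
pose f u := if N y u then 0 else if N x u then 3 else nth 5 [:: 1; 2; 4] (index u s).
have f_nth i : i < 4 -> f (nth x s i) = nth 5 [:: 1; 2; 4] i.
  move=> lt_i; have /s_out : nth x s i \in s by rewrite mem_nth ?s_size.
  by rewrite !inE /f negb_or index_uniq ?s_size // => /andP[/negbTE-> /negbTE->].
apply: (@nonadj_labelling_H2 6 f) => // [u|i|u v uv].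
- rewrite /f; case: ifP => // _; case: ifP => // _.
  by case: (index u s) => [|[|[|n]]] //=; rewrite nth_nil.
- case: i => [|[|[|[|[|[|//]]]]]] _.
  + by exists x; rewrite /f yx.
  + by exists (nth x s 0); rewrite f_nth.
  + by exists (nth x s 1); rewrite f_nth.
  + by exists y; rewrite /f xy bicliques_irrefl.
  + by exists (nth x s 2); rewrite f_nth.
  + by exists (nth x s 3); rewrite f_nth.
rewrite /f; case/orP: (only _ _ uv) => h.
- have yv : N y v by apply: (bicliques_walk3 hN) h uv.
  by rewrite yv h; case: ifP => [/disj|] //; case: (h).
- have xv : N x v by apply: (bicliques_walk3 hN) h uv.
  by rewrite xv h; case: ifP => [/disj|] //; case: (xv).
Qed.

Section TwoBicliques.

Variables x1 y1 x2 y2 : G.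
Hypothesis pair : biclique_pair N x1 y1 x2 y2.

Let cls := block N x1 y1 x2 y2.

Lemma cls_cases x : cls x < 4 \/ cls x = 4.
Proof. by rewrite /cls /block; do 4?[case: ifP => _; first by left]; right. Qed.

Lemma mem_nbr_block : [/\ forall x, x \in nbr N y1 -> cls x = 0,
  forall x, x \in nbr N x1 -> cls x = 1, forall x, x \in nbr N y2 -> cls x = 2
  & forall x, x \in nbr N x2 -> cls x = 3].
Proof.
have [B0 B1 B2 B3] := blockP hN pair.
by split=> x; rewrite inE => h; apply/eqP; rewrite ?B0 ?B1 ?B2 ?B3.
Qed.

(* Order A C R B D R', where [side] splits the remaining vertices into R and R'. *)
Lemma H2_large_rest (side : G -> bool) r r' :
    (forall x y, N x y -> cls x = 4 -> side x != side y) ->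
    cls r = 4 -> cls r' = 4 -> side r -> ~~ side r' -> has_H2 G.
Proof.
move=> bip clsr clsr' sr sr'; have [cx1 cy1 cx2 cy2] := block_reps hN pair.
(* Entries follow the blocks A, B, C, D, rest. Modulo 6 the pairs 0 and 3, 1 and 4, 2 and 5 are all
   opposite. *)
pose f x := nth 0 [:: 0; 3; 1; 4; if side x then 2 else 5] (cls x).
apply: (@nonadj_labelling_H2 6 f) => // [x|i|x y xy].
- by rewrite /f; have [|->] := cls_cases x; [case: (cls x) => [|[|[|[|]]]] | case: ifP].
- case: i => [|[|[|[|[|[|//]]]]]] _.
  + by exists x1; rewrite /f /cls cx1.
  + by exists x2; rewrite /f /cls cx2.
  + by exists r; rewrite /f clsr sr.
  + by exists y1; rewrite /f /cls cy1.
  + by exists y2; rewrite /f /cls cy2.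
  + by exists r'; rewrite /f clsr' (negbTE sr').
rewrite /f [cls y](block_mate hN pair xy) -/(cls x).
have [|clsx] := cls_cases x; first by case: (cls x) => [|[|[|[|]]]].
by rewrite clsx; have := bip _ _ xy clsx; case: (side x); case: (side y).
Qed.

(* Order A A C s B D D. *)
Lemma H2_single_rest s : (forall x, (cls x < 4) = (x != s)) ->
  1 < nb y1 -> 1 < nb x2 -> has_H2 G.
Proof.
move=> rest /(exists_other x1) [a /[swap] neq_a Aa] /(exists_other y2) [d /[swap] neq_d Dd].
have clss : cls s = 4 by have [|//] := cls_cases s; rewrite rest eqxx.
have only x : cls x = 4 -> x = s by move=> clsx; apply/eqP; rewrite -[_ == _]negbK -rest clsx.
have [cx1 cy1 cx2 cy2] := block_reps hN pair; have [M0 M1 M2 M3] := mem_nbr_block.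
(* The boolean reserves the first label of A for [x1] and of D for [y2]; the other members share the
   next one. Mates then differ by 3 or 4 modulo 7. *)
pose f x := nth 0 [:: x != x1 : nat; 4; 2; 5 + (x != y2); 3] (cls x).
apply: (@nonadj_labelling_H2 7 f) => // [x|i|x y xy].
- rewrite /f; have [|->//] := cls_cases x.
  by case: (cls x) => [|[|[|[|]]]] //= _; case: (_ == _).
- case: i => [|[|[|[|[|[|[|//]]]]]]] _.
  + by exists x1; rewrite /f /cls cx1 /= eqxx.
  + by exists a; rewrite /f M0 //= neq_a.
  + by exists x2; rewrite /f /cls cx2.
  + by exists s; rewrite /f clss.
  + by exists y1; rewrite /f /cls cy1.
  + by exists y2; rewrite /f /cls cy2 /= eqxx.
  + by exists d; rewrite /f M3 //= neq_d.
have clsy : cls y = nth 4 [:: 1; 0; 3; 2] (cls x) by apply: (block_mate hN pair).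
rewrite /f clsy; have [|clsx] := cls_cases x.
  by case: (cls x) => [|[|[|[|]]]] //= _; do 2?case: (_ == _).
by move: xy; rewrite (only x) // (only y) ?bicliques_irrefl // clsy clsx.
Qed.

Hypothesis spanning : forall x, cls x < 4.

(* Order A A C C B B D D. *)
Lemma H2_all_large : 1 < nb y1 -> 1 < nb x1 -> 1 < nb y2 -> 1 < nb x2 -> has_H2 G.
Proof.
move=> /(exists_other x1) [a /[swap] neq_a Aa] /(exists_other y1) [b /[swap] neq_b Bb].
move=> /(exists_other x2) [c /[swap] neq_c Cc] /(exists_other y2) [d /[swap] neq_d Dd].
have [cx1 cy1 cx2 cy2] := block_reps hN pair; have [M0 M1 M2 M3] := mem_nbr_block.
pose f x := nth 0 [:: x != x1 : nat; 4 + (x != y1); 2 + (x != x2); 6 + (x != y2)] (cls x).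
apply: (@nonadj_labelling_H2 8 f) => // [x|i|x y xy].
- by rewrite /f; have := spanning x; case: (cls x) => [|[|[|[|]]]] //= _; case: (_ == _).
- case: i => [|[|[|[|[|[|[|[|//]]]]]]]] _.
  + by exists x1; rewrite /f /cls cx1 /= eqxx.
  + by exists a; rewrite /f M0 //= neq_a.
  + by exists x2; rewrite /f /cls cx2 /= eqxx.
  + by exists c; rewrite /f M2 //= neq_c.
  + by exists y1; rewrite /f /cls cy1 /= eqxx.
  + by exists b; rewrite /f M1 //= neq_b.
  + by exists y2; rewrite /f /cls cy2 /= eqxx.
  + by exists d; rewrite /f M3 //= neq_d.
rewrite /f [cls y](block_mate hN pair xy) -/(cls x); have := spanning x.
by case: (cls x) => [|[|[|[|]]]] //= _; do 2?case: (_ == _).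
Qed.

(* Order C C A C C B B D B B. *)
Lemma H2_two_very_large : 4 <= nb x1 -> 4 <= nb y2 -> has_H2 G.
Proof.
move=> /card_geqP [b [b_uniq b_size Bb]] /card_geqP [c [c_uniq c_size Cc]].
have [cx1 cy1 cx2 cy2] := block_reps hN pair; have [M0 M1 M2 M3] := mem_nbr_block.
(* Three chosen vertices of B get 5, 6, 8 and all others share 9; likewise 0, 1, 3 and 4 in C. With
   A at 2 and D at 7, even singletons A and D are far enough from their mates modulo 10. *)
pose fb x := nth 9 [:: 5; 6; 8] (index x b).
pose fc x := nth 4 [:: 0; 1; 3] (index x c).
have fbE x : [\/ fb x = 5, fb x = 6, fb x = 8 | fb x = 9].
  by rewrite /fb; case: (index x b) => [|[|[|n]]] /=; rewrite ?nth_nil;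
    [constructor 1|constructor 2|constructor 3|constructor 4].
have fcE x : [\/ fc x = 0, fc x = 1, fc x = 3 | fc x = 4].
  by rewrite /fc; case: (index x c) => [|[|[|n]]] /=; rewrite ?nth_nil;
    [constructor 1|constructor 2|constructor 3|constructor 4].
pose f x := nth 0 [:: 2; fb x; fc x; 7] (cls x).
have f_b i : i < 4 -> f (nth x1 b i) = nth 9 [:: 5; 6; 8] i.
  move=> lt_i; rewrite /f M1 ?Bb ?mem_nth ?b_size //=.
  by rewrite /fb index_uniq ?b_size.
have f_c i : i < 4 -> f (nth x1 c i) = nth 4 [:: 0; 1; 3] i.
  move=> lt_i; rewrite /f M2 ?Cc ?mem_nth ?c_size //=.
  by rewrite /fc index_uniq ?c_size.
apply: (@nonadj_labelling_H2 10 f) => // [x|i|x y xy].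
- rewrite /f; have := spanning x; case: (cls x) => [|[|[|[|]]]] //= _.
    by case: (fbE x) => ->.
  by case: (fcE x) => ->.
- case: i => [|[|[|[|[|[|[|[|[|[|//]]]]]]]]]] _.
  + by exists (nth x1 c 0); rewrite f_c.
  + by exists (nth x1 c 1); rewrite f_c.
  + by exists x1; rewrite /f /cls cx1.
  + by exists (nth x1 c 2); rewrite f_c.
  + by exists (nth x1 c 3); rewrite f_c.
  + by exists (nth x1 b 0); rewrite f_b.
  + by exists (nth x1 b 1); rewrite f_b.
  + by exists y2; rewrite /f /cls cy2.
  + by exists (nth x1 b 2); rewrite f_b.
  + by exists (nth x1 b 3); rewrite f_b.
rewrite /f [cls y](block_mate hN pair xy) -/(cls x); have := spanning x.
by case: (cls x) => [|[|[|[|]]]] //= _;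
  [case: (fbE y) | case: (fbE x) | case: (fcE x) | case: (fcE y)] => ->.
Qed.

(** When the two bicliques cover all vertices, [block_complete] makes adjacency of distinct vertices
    depend on their blocks alone, so enumerating the sides gives the isomorphism. *)
Lemma iso_clique_join : isomorphic G (clique_join (nb y1) (nb x1) (nb y2) (nb x2)).
Proof.
have [M0 M1 M2 M3] := mem_nbr_block; have [B0 B1 B2 B3] := blockP hN pair.
pose g (u : clique_join (nb y1) (nb x1) (nb y2) (nb x2)) : G :=
  match u with
  | inl (inl i) | inl (inr i) | inr (inl i) | inr (inr i) => enum_val i
  end.
pose part (u : clique_join (nb y1) (nb x1) (nb y2) (nb x2)) : nat :=
  match u with inl (inl _) => 0 | inl (inr _) => 1 | inr (inl _) => 2 | inr (inr _) => 3 end.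
have cls_g u : cls (g u) = part u.
  by case: u => [[i|i]|[i|i]]; [apply: M0|apply: M1|apply: M2|apply: M3]; apply: enum_valP.
have g_inj : injective g.
  move=> u v eq_uv; have : part u = part v by rewrite -!cls_g eq_uv.
  by case: u v eq_uv => [[i|i]|[i|i]] [[j|j]|[j|j]] //= /enum_val_inj ->.
have g_edge u v : edge (g u) (g v) = edge u v.
  rewrite edgeE (inj_eq g_inj) (block_complete hN pair) -/cls !cls_g; last by case: u => [[]|[]].
  by case: u => [[i|i]|[i|i]]; case: v => [[j|j]|[j|j]] //=; rewrite andbT.
have g_onto x : exists u, g u = x.
  have := spanning x; case E : (cls x) => [|[|[|[|//]]]] _;
    move/eqP: E; rewrite ?B0 ?B1 ?B2 ?B3 => h.
  - have Ax : x \in nbr N y1 by rewrite inE.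
    by exists (inl (inl (enum_rank_in Ax x))); rewrite /= enum_rankK_in.
  - have Ax : x \in nbr N x1 by rewrite inE.
    by exists (inl (inr (enum_rank_in Ax x))); rewrite /= enum_rankK_in.
  - have Ax : x \in nbr N y2 by rewrite inE.
    by exists (inr (inl (enum_rank_in Ax x))); rewrite /= enum_rankK_in.
  - have Ax : x \in nbr N x2 by rewrite inE.
    by exists (inr (inr (enum_rank_in Ax x))); rewrite /= enum_rankK_in.
have [f fK] := fin_all_exists g_onto.
exists f => [|x y]; last by rewrite -g_edge !fK.
by exists g => // u; apply: g_inj; rewrite fK.
Qed.

End TwoBicliques.

End Arrangements.

(** * Case analysis on the sizes of the sides *)

Lemma block_rest_flip1 (T : finType) (N : rel T) x1 y1 x2 y2 x :
  (block N y1 x1 x2 y2 x < 4) = (block N x1 y1 x2 y2 x < 4).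
Proof. by rewrite !block_rest orbCA. Qed.

Lemma block_rest_swap (T : finType) (N : rel T) x1 y1 x2 y2 x :
  (block N x2 y2 x1 y1 x < 4) = (block N x1 y1 x2 y2 x < 4).
Proof. by rewrite !block_rest orbA orbC -orbA. Qed.

Lemma block_rest_flip2 (T : finType) (N : rel T) x1 y1 x2 y2 x :
  (block N x1 y1 y2 x2 x < 4) = (block N x1 y1 x2 y2 x < 4).
Proof. by rewrite !block_rest [N x2 x || _]orbC. Qed.

(** Let [a <= b] and [c <= d] be the sizes of the sides, with [a <= c]. If [a >= 2], all sides are
    large. If [a = 1], then [b = 3] is family (i), and [b, d >= 4] has an arrangement; otherwise
    [d <= 3] leaves [(c, d)] among (1,3), (2,2), (2,3), (3,3), one exceptional family each. *)
Lemma exceptional_spanning_pair (G : sgraph) (x1 y1 x2 y2 : G) (N := @nonadj G) :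
    bicliques N -> biclique_pair N x1 y1 x2 y2 ->
    (forall x, block N x1 y1 x2 y2 x < 4) ->
    4 <= #|nbr N y1| + #|nbr N x1| -> 4 <= #|nbr N y2| + #|nbr N x2| ->
  ~ exceptional G -> has_H2 G.
Proof.
move=> hN pair span n1 n2 exc; rewrite {}/N in hN pair span n1 n2.
(* The bicliques are compared through the minima of their sides, which the later exchanges of sides
   preserve. *)
wlog ac : x1 y1 x2 y2 pair span n1 n2 /
    minn #|nbr (@nonadj G) y1| #|nbr (@nonadj G) x1| <=
    minn #|nbr (@nonadj G) y2| #|nbr (@nonadj G) x2|.
  move=> hyp; have /orP[lt|lt] := leq_total (minn #|nbr (@nonadj G) y1| #|nbr (@nonadj G) x1|)
    (minn #|nbr (@nonadj G) y2| #|nbr (@nonadj G) x2|); first exact: hyp lt.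
  apply: (hyp _ _ _ _ (biclique_pair_swap hN pair) _ n2 n1 lt) => x.
  by rewrite block_rest_swap.
wlog ab : x1 y1 pair span n1 ac / #|nbr (@nonadj G) y1| <= #|nbr (@nonadj G) x1|.
  move=> hyp; have /orP[lt|lt] := leq_total #|nbr (@nonadj G) y1| #|nbr (@nonadj G) x1|.
    exact: hyp lt.
  apply: (hyp _ _ (biclique_pair_flip1 hN pair) _ _ _ lt).
  - by move=> x; rewrite block_rest_flip1.
  - by rewrite addnC.
  - by rewrite minnC.
wlog cd : x2 y2 pair span n2 ac / #|nbr (@nonadj G) y2| <= #|nbr (@nonadj G) x2|.
  move=> hyp; have /orP[lt|lt] := leq_total #|nbr (@nonadj G) y2| #|nbr (@nonadj G) x2|.
    exact: hyp lt.
  apply: (hyp _ _ (biclique_pair_flip2 hN pair) _ _ _ lt).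
  - by move=> x; rewrite block_rest_flip2.
  - by rewrite addnC.
  - by rewrite [X in _ <= X]minnC.
have span' x : block (@nonadj G) x2 y2 x1 y1 x < 4 by rewrite block_rest_swap.
have span2 x : block (@nonadj G) x1 y1 y2 x2 x < 4 by rewrite block_rest_flip2.
have pair' := biclique_pair_swap hN pair.
have iso := iso_clique_join hN pair span.
(* The last cases need the bicliques in reverse order, since the families list the sides of sizes 1
   and [m] second. *)
have iso' := iso_clique_join hN pair' span'.
have pos x y : nonadj x y -> 0 < #|nbr (@nonadj G) x|.
  by move=> xy; apply/card_gt0P; exists y; rewrite inE.
have [N1 N2 _ _] := and4P pair.
have a_pos := pos y1 x1 ltac:(by rewrite nonadj_sym).
have c_pos := pos y2 x2 ltac:(by rewrite nonadj_sym).
(* C and D are exchanged because the larger sides are now B and D, whereas the arrangement asks for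
   large B and C. *)
have flip := H2_two_very_large hN (biclique_pair_flip2 hN pair) span2.
have large := H2_all_large hN pair span.
move: n1 n2 ac ab cd iso iso' a_pos c_pos flip large {pos}.
move: #|nbr _ y1| #|nbr _ x1| #|nbr _ y2| #|nbr _ x2| => a b c d.
move=> n1 n2 ac ab cd iso iso' a_pos c_pos flip large.
have [a_gt1|a_le1] := ltnP 1 a; first by apply: large; lia.
have a1 : a = 1 by lia.
rewrite {}a1 in iso iso' n1.
have [b4|b_lt4] := leqP 4 b; last first.
  have b3 : b = 3 by lia.
  by case: exc; constructor 1; exists c, d; split; rewrite -?b3 //; lia.
have [d4|d_lt4] := leqP 4 d; first exact: flip.
case: exc; have : [\/ c = 1 /\ d = 3, c = 2 /\ d = 2, c = 2 /\ d = 3 | c = 3 /\ d = 3].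
  have [c1|[c2|c3]] : c = 1 \/ c = 2 \/ c = 3 by lia.
  - by constructor 1; lia.
  - have [d2|d3] : d = 2 \/ d = 3 by lia.
      by constructor 2.
    by constructor 3.
  - by constructor 4; lia.
move=> cases; case: cases iso' => -[-> ->] iso'.
- by constructor 1; exists 1, b; split=> //; lia.
- by constructor 2; exists b => //; lia.
- by constructor 3; exists b => //; lia.
- by constructor 4; exists b => //; lia.
Qed.

Theorem theorem3 (G : sgraph) (hconn : k_connected 4 G)
    (hfree : claw_P4_free G) (hexc : ~ exceptional G) : has_H2 G.
Proof.
have hN := nonadj_bicliques hconn isT hfree.
have outside x y (xy : nonadj x y) := card_outside_biclique hconn hN xy.
have [/existsP[x1 /existsP[y1 xy1]]|] := boolP [exists x : G, exists y, nonadj x y]; last first.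
  move=> /existsPn none; apply: H2_complete => [x y|].
    by have /existsPn := none x; apply.
  by case: hconn => + _; apply: leq_trans.
have [/existsP[x2 /existsP[y2 /and3P[xy2 x12 yx12]]]|] :=
    boolP [exists x : G, exists y, [&& nonadj x y, ~~ nonadj x1 x & ~~ nonadj y1 x]];
  last first.
  move=> /existsPn only; apply: (H2_one_biclique hN xy1 (outside _ _ xy1)) => u v uv.
  by have /existsPn/(_ v) := only u; rewrite uv /= -negb_or negbK.
have pair : biclique_pair (@nonadj G) x1 y1 x2 y2.
  by rewrite /biclique_pair xy1 xy2 x12.
pose rest := [set x | 4 <= block (@nonadj G) x1 y1 x2 y2 x].
have in_rest x : (x \in rest) = ~~ (block (@nonadj G) x1 y1 x2 y2 x < 4).
  by rewrite inE leqNgt.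
have out1 : 4 <= #|nbr (@nonadj G) y2| + #|nbr (@nonadj G) x2| + #|rest|.
  exact: leq_trans (outside _ _ xy1) (card_outside_le _ _ _ _ _).
have out2 : 4 <= #|nbr (@nonadj G) y1| + #|nbr (@nonadj G) x1| + #|rest|.
  have <- : [set x | 4 <= block (@nonadj G) x2 y2 x1 y1 x] = rest.
    by apply/setP => x; rewrite in_rest inE leqNgt block_rest_swap.
  exact: leq_trans (outside _ _ xy2) (card_outside_le _ _ _ _ _).
have rest_block x : x \in rest -> block (@nonadj G) x1 y1 x2 y2 x = 4.
  by rewrite in_rest; have [->|] := cls_cases x1 y1 x2 y2 x.
have [/card_gt1P[r [r' [rest_r rest_r' neq_r]]]|] := ltnP 1 #|rest|.
  (* Two nonadjacent remaining vertices lie on different sides of a bipartition, which serves as the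
     split. If there are none, the remaining vertices form a clique and separating [r] from the
     others suffices. *)
  have [/existsP[u /existsP[v /andP[rest_u uv]]]|] :=
      boolP [exists u, exists v, (u \in rest) && nonadj u v].
    have [side bip] := bicliques_bipartite hN.
    have rest_v : v \in rest.
      by rewrite in_rest (block_mate hN pair uv) rest_block.
    have large w w' := @H2_large_rest G hN x1 y1 x2 y2 pair side w w' (fun x y xy _ => bip x y xy).
    have := bip _ _ uv; case side_u : (side u); case side_v : (side v) => // _.
      by apply: (large u v); rewrite ?rest_block ?side_v.
    by apply: (large v u); rewrite ?rest_block ?side_u.
  move=> /existsPn indep.
  apply: (@H2_large_rest G hN x1 y1 x2 y2 pair (pred1 r) r r');
    rewrite ?rest_block //= ?eqxx // 1?eq_sym // => x y xy block_x.
  by have /existsPn/(_ y) := indep x; rewrite xy in_rest block_x.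
rewrite leq_eqVlt ltnS leqn0 => /orP[/cards1P[s rest_s]|/eqP rest0].
  have rest1 x : (block (@nonadj G) x1 y1 x2 y2 x < 4) = (x != s).
    by rewrite -[_ < _]negbK -in_rest rest_s inE.
  rewrite rest_s cards1 in out1 out2.
  (* With a single remaining vertex, the sides of each biclique have sizes summing to at least
     three, so one of the two has at least two vertices; exchanges make these A and D. *)
  wlog a_gt1 : x1 y1 pair rest1 {xy1 x12 yx12 rest in_rest rest_s rest_block}
      out1 out2 /
      1 < #|nbr (@nonadj G) y1|.
    move=> hyp; have [a_gt1|a_le1] := ltnP 1 #|nbr (@nonadj G) y1|.
      exact: (hyp x1 y1).
    apply: (hyp y1 x1 (biclique_pair_flip1 hN pair)) => //; last by lia.
    - by move=> x; rewrite block_rest_flip1.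
    - by rewrite [_ + #|nbr _ y1|]addnC.
  have [d_gt1|d_le1] := ltnP 1 #|nbr (@nonadj G) x2|.
    exact: (H2_single_rest hN pair rest1).
  apply: (H2_single_rest hN (biclique_pair_flip2 hN pair) (s := s)) => // [x|].
    by rewrite block_rest_flip2.
  by lia.
rewrite rest0 !addn0 in out1 out2.
apply: (exceptional_spanning_pair hN pair) => // x.
by rewrite -[_ < _]negbK -in_rest (cards0_eq rest0) inE.
Qed.
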